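(* CBLP does not imply FCLP; that is, there exists a congruence-distributive algebra which has CBLP but does not have FCLP.
   Context: Algebras are non-empty universal algebras. For an algebra $A$, $\mathrm{Con}(A)$ is the bounded lattice of congruences of $A$ ordered by inclusion, with meet $\cap$, join $\phi\vee\psi$ = the congruence generated by $\phi\cup\psi$, least element $\Delta_A=\{(a,a)\mid a\in A\}$ and greatest element $\nabla_A=A^2$. $A$ is congruence-distributive if the lattice $\mathrm{Con}(A)$ is distributive (e.g. every lattice is a congruence-distributive algebra); quotients of congruence-distributive algebras are congruence-distributive. For a bounded distributive lattice $L$, $\mathcal{B}(L)$ is the Boolean algebra of complemented elements of $L$. Composition: $\phi\circ\psi=\{(a,b)\in A^2\mid \exists x\in A,\ (a,x)\in\psi,\ (x,b)\in\phi\}$. Let $A$ be congruence-distributive. A congruence $\phi$ of $A$ is a factor congruence if there is $\phi^*\in\mathrm{Con}(A)$ with $\phi\vee\phi^*=\nabla_A$, $\phi\cap\phi^*=\Delta_A$ and $\phi\circ\phi^*=\phi^*\circ\phi$. $\mathrm{FC}(A)$ is the set of factor congruences; it is a Boolean subalgebra of $\mathcal{B}(\mathrm{Con}(A))$. For $\theta\in\mathrm{Con}(A)$, the map $u_\theta:\mathrm{Con}(A)\to\mathrm{Con}(A/\theta)$, $u_\theta(\alpha)=(\alpha\vee\theta)/\theta=\{(a/\theta,b/\theta)\mid(a,b)\in\alpha\vee\theta\}$, is a bounded lattice morphism which maps $\mathrm{FC}(A)$ into $\mathrm{FC}(A/\theta)$ and $\mathcal{B}(\mathrm{Con}(A))$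 into $\mathcal{B}(\mathrm{Con}(A/\theta))$. The congruence $\theta$ has FCLP (Factor Congruence Lifting Property) if the restriction $u_\theta|:\mathrm{FC}(A)\to\mathrm{FC}(A/\theta)$ is surjective; $\theta$ has CBLP (Congruence Boolean Lifting Property) if the restriction $u_\theta|:\mathcal{B}(\mathrm{Con}(A))\to\mathcal{B}(\mathrm{Con}(A/\theta))$ is surjective. $A$ has FCLP (respectively CBLP) if every congruence of $A$ has FCLP (respectively CBLP). *)

(* Defs.v *)
From HB Require Import structures.
From mathcomp Require Import all_boot all_order.
From mathcomp Require Import all_classical.

Set Implicit Arguments.
Unset Strict Implicit.
Unset Printing Implicit Defensive.

Import Order.Theory.

Local Open Scope classical_set_scope.
Local Open Scope order_scope.

Record signature := Signature {
  symbol : Type;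
  arity : symbol -> nat
}.

Record algebra (S : signature) := Algebra {
  carrier :> Type;
  op : forall f : symbol S, ('I_(arity f) -> carrier) -> carrier;
  carrier_inhabited : inhabited carrier
}.

Arguments op {S a} f _.

Section Congruences.
Context {S : signature} {A : algebra S}.
Implicit Types R Q : set (A * A).

Definition is_congruence R : Prop :=
  [/\ forall a, R (a, a),
      forall a b, R (a, b) -> R (b, a),
      forall a b c, R (a, b) -> R (b, c) -> R (a, c) &
      forall (f : symbol S) (a b : 'I_(arity f) -> A),
        (forall i, R (a i, b i)) -> R (op f a, op f b)].

Lemma is_congruence_bigcap (F : set (set (A * A))) :
  F `<=` is_congruence -> is_congruence (\bigcap_(R in F) R).
Proof.
move=> FC; split=> [a|a b ab|a b c ab bc|f a b ab] R FR;
  have [r s t c'] := FC _ FR.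
- exact: r.
- by apply: s; exact: ab.
- exact: t (ab _ FR) (bc _ FR).
- by apply: c' => i; exact: ab.
Qed.

Lemma is_congruence_smallest R : is_congruence (smallest is_congruence R).
Proof. by apply: is_congruence_bigcap => Q []. Qed.

Lemma is_congruence_setI R Q :
  is_congruence R -> is_congruence Q -> is_congruence (R `&` Q).
Proof.
move=> [r s t c] [r' s' t' c']; split=> [a|a b []|x y z [? ?] []|f a b ab].
- by split.
- by move=> /s ? /s' ?; split.
- by move=> yz yz'; split; [apply: t yz | apply: t' yz'].
- by split; [apply: c | apply: c'] => i; case: (ab i).
Qed.

Lemma is_congruence_diagonal : is_congruence (@diagonal A).
Proof.
split=> [//|a b|a b c|f a b ab]; rewrite /diagonal /=.
- by move=> ->.
- by move=> -> ->.
- by congr (op f); apply/funext.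
Qed.

Lemma is_congruence_setT : is_congruence [set: A * A].
Proof. by []. Qed.

End Congruences.

Record Con {S : signature} (A : algebra S) := MkCon {
  con_rel :> set (A * A);
  conP : is_congruence con_rel
}.

Section ConLattice.
Context {S : signature} {A : algebra S}.
Implicit Types phi psi chi : Con A.

Lemma con_inj : injective (@con_rel S A).
Proof.
by move=> [R Rc] [Q Qc] /= RQ; case: Q / RQ Qc => Qc; congr MkCon.
Qed.

HB.instance Definition _ := gen_eqMixin (Con A).
HB.instance Definition _ := gen_choiceMixin (Con A).

Definition con_le : rel (Con A) := fun phi psi => `[< phi `<=` psi >].

Definition con_meet phi psi : Con A :=
  MkCon (is_congruence_setI (conP phi) (conP psi)).

Definition con_join phi psi : Con A :=
  MkCon (is_congruence_smallest (phi `|` psi)%classic).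

Definition con_bot : Con A := MkCon is_congruence_diagonal.

Definition con_top : Con A := MkCon is_congruence_setT.

Lemma con_le_refl : reflexive con_le.
Proof. by move=> phi; apply/asboolP. Qed.

Lemma con_le_anti : antisymmetric con_le.
Proof.
move=> phi psi /andP[/asboolP le1 /asboolP le2].
by apply: con_inj; apply/seteqP; split.
Qed.

Lemma con_le_trans : transitive con_le.
Proof.
move=> psi phi chi /asboolP le1 /asboolP le2.
by apply/asboolP; exact: subset_trans le2.
Qed.

Lemma con_meetP phi psi chi :
  con_le phi (con_meet psi chi) = con_le phi psi && con_le phi chi.
Proof.
apply/asboolP/andP => [|[/asboolP le1 /asboolP le2]].
  by rewrite /= subsetI => -[? ?]; split; apply/asboolP.
by rewrite /= subsetI; split.
Qed.

Lemma con_joinP phi psi chi :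
  con_le (con_join phi psi) chi = con_le phi chi && con_le psi chi.
Proof.
apply/asboolP/andP => [le1|[/asboolP le1 /asboolP le2]].
  by split; apply/asboolP => x xR; apply: le1; apply: sub_gen_smallest;
    [left | right].
apply: smallest_sub; first exact: conP.
by rewrite subUset; split.
Qed.

Lemma con_le0 phi : con_le con_bot phi.
Proof.
have [r _ _ _] := conP phi.
by apply/asboolP => x; case: x => a b /diagonalP <-; exact: r.
Qed.

Lemma con_le1 phi : con_le phi con_top.
Proof. exact/asboolP. Qed.

Fact con_display : Order.disp_t. Proof. exact: Order.Disp tt tt. Qed.

HB.instance Definition _ := Order.Le_isPOrder.Build con_display (Con A)
  con_le_refl con_le_anti con_le_trans.
HB.instance Definition _ :=
  Order.POrder_MeetJoin_isLattice.Build con_display (Con A)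
    con_meetP con_joinP.
HB.instance Definition _ := Order.hasBottom.Build con_display (Con A) con_le0.
HB.instance Definition _ := Order.hasTop.Build con_display (Con A) con_le1.

Lemma con_leE phi psi : (phi <= psi) = `[< phi `<=` psi >].
Proof. by []. Qed.

Lemma con_meetE phi psi : phi `&` psi = (phi `&` psi)%classic :> set (A * A).
Proof. by []. Qed.

Lemma con_joinE phi psi :
  phi `|` psi = smallest is_congruence (phi `|` psi)%classic :> set (A * A).
Proof. by []. Qed.

Lemma con_botE : (\bot : Con A) = @diagonal A :> set (A * A).
Proof. by []. Qed.

Lemma con_topE : (\top : Con A) = [set: A * A] :> set (A * A).
Proof. by []. Qed.

End ConLattice.

Definition complemented {d : Order.disp_t} (L : tbLatticeType d) : set L :=
  [set x | exists y : L, x `&` y = \bot /\ x `|` y = \top].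

Arguments complemented {d} L.

Definition congruence_distributive {S : signature} (A : algebra S) : Prop :=
  left_distributive (@Order.meet _ (Con A)) (@Order.join _ (Con A)).

(* In relation_scope, [(a, b)] is in [phi \; psi] iff [(a, x)] is in [psi] and
   [(x, b)] is in [phi] for some [x]. *)
Definition FC {S : signature} (A : algebra S) : set (Con A) :=
  [set phi | exists phi' : Con A,
    [/\ phi `|` phi' = \top, phi `&` phi' = \bot &
        (con_rel phi \; con_rel phi' = con_rel phi' \; con_rel phi)%relation]].

Arguments FC {S} A.

Section Quotient.
Context {S : signature} {A : algebra S} (theta : Con A).

Definition con_class (a : A) : set A := [set b | con_rel theta (a, b)].

Definition quot_carrier : Type := {X : set A | range con_class X}.

Definition quot_pi (a : A) : quot_carrier := exist _ _ (imageT con_class a).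

Definition quot_repr (x : quot_carrier) : A := sval (cid2 (proj2_sig x)).

Lemma quot_reprK : cancel quot_repr quot_pi.
Proof.
case=> X XP; rewrite /quot_repr /=; case: cid2 => a /= _ aX.
exact: eq_exist.
Qed.

Lemma con_classP (a b : A) :
  con_class a = con_class b <-> con_rel theta (a, b).
Proof.
have [r s t _] := conP theta; split=> [ab|ab].
  have : con_class b b by exact: r.
  by rewrite -ab.
apply/seteqP; split=> c; rewrite /con_class /=.
  by apply: t; exact: s.
exact: t.
Qed.

Lemma quot_piP (a b : A) : quot_pi a = quot_pi b <-> con_rel theta (a, b).
Proof.
split=> [/(congr1 sval)/con_classP//|/con_classP ab].
exact: eq_exist.
Qed.

(* Independent of the choice of representatives, see [quot_opE]. *)
Definition quot_op (f : symbol S) (x : 'I_(arity f) -> quot_carrier) :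
  quot_carrier := quot_pi (op f (fun i => quot_repr (x i))).

Lemma quot_inhabited : inhabited quot_carrier.
Proof. by have [a] := carrier_inhabited A; split; exact: quot_pi a. Qed.

Definition quot : algebra S := Algebra quot_op quot_inhabited.

Lemma quot_opE (f : symbol S) (a : 'I_(arity f) -> A) :
  op f (fun i => quot_pi (a i) : quot) = quot_pi (op f a).
Proof.
apply/quot_piP; have [_ _ _ c] := conP theta; apply: c => i.
by apply/quot_piP; exact: quot_reprK.
Qed.

Definition u_rel (alpha : Con A) : set (quot * quot) :=
  [set (quot_pi p.1 : quot, quot_pi p.2 : quot) | p in con_rel (alpha `|` theta)].

Lemma u_relP (alpha : Con A) (a b : A) :
  u_rel alpha (quot_pi a, quot_pi b) <->
  con_rel (alpha `|` theta) (a, b).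
Proof.
split=> [[[a' b'] ab' [aa bb]]|ab]; last by exists (a, b).
have thj : con_rel theta `<=` con_rel (alpha `|` theta).
  by move=> x ?; apply: sub_gen_smallest; right.
have [_ s t _] := conP (alpha `|` theta).
move/con_classP/thj: aa => aa; move/con_classP/thj: bb => bb.
exact: t (t _ _ _ (s _ _ aa) ab') bb.
Qed.

Lemma u_is_congruence (alpha : Con A) : is_congruence (u_rel alpha).
Proof.
have [r s t c] := conP (alpha `|` theta).
split=> [x|x y|x y z|f x y].
- by rewrite -(quot_reprK x); apply/u_relP; exact: r.
- rewrite -(quot_reprK x) -(quot_reprK y) => /u_relP xy.
  by apply/u_relP; exact: s.
- rewrite -(quot_reprK x) -(quot_reprK y) -(quot_reprK z).
  by move=> /u_relP xy /u_relP yz; apply/u_relP; exact: t yz.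
- move=> xy; apply/u_relP; apply: c => i.
  by apply/u_relP; rewrite !quot_reprK; exact: xy.
Qed.

Definition u (alpha : Con A) : Con quot := MkCon (u_is_congruence alpha).

Definition con_FCLP : Prop := set_surj (FC A) (FC quot) u.

Definition con_CBLP : Prop :=
  set_surj (complemented (Con A)) (complemented (Con quot)) u.

End Quotient.

Definition FCLP {S : signature} (A : algebra S) : Prop :=
  forall theta : Con A, con_FCLP theta.

Definition CBLP {S : signature} (A : algebra S) : Prop :=
  forall theta : Con A, con_CBLP theta.

(* Main.v *)
(** Add a new top [None] to the four-element Boolean lattice. The resulting
    distributive lattice embeds in [2^3] through three coordinates, and its
    congruences are exactly the kernels of the sets of coordinates; hence the
    congruence lattice is Boolean, every congruence is complemented, and CBLP
    reduces to the surjectivity of each [u theta]. Collapsing the new top to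
    the one below it gives back [2 x 2], whose two projections are factor
    congruences; they do not lift to factor congruences since a lattice with
    a join-irreducible top is directly indecomposable. *)
Require Import Defs.
From HB Require Import structures.
From mathcomp Require Import all_boot all_order.
From mathcomp Require Import all_classical.

Set Implicit Arguments.
Unset Strict Implicit.
Unset Printing Implicit Defensive.

Import Order.Theory.

Local Open Scope classical_set_scope.
Local Open Scope order_scope.

(** * Congruences of a quotient and a sufficient condition for CBLP *)

Lemma con_leP (S : signature) (A : algebra S) (phi psi : Con A) :
  reflect (con_rel phi `<=` con_rel psi) (phi <= psi).
Proof. by rewrite con_leE; exact: asboolP. Qed.

Lemma con_eqP (S : signature) (A : algebra S) (phi psi : Con A) :
  (forall x y, con_rel phi (x, y) <-> con_rel psi (x, y)) -> phi = psi.
Proof. by move=> E; apply/con_inj/seteqP; split=> -[x y] /E. Qed.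

Lemma con_trans (S : signature) (A : algebra S) (phi : Con A) (a b c : A) :
  con_rel phi (a, b) -> con_rel phi (b, c) -> con_rel phi (a, c).
Proof. by have [_ _ t _] := conP phi; exact: t. Qed.

Section QuotientPullback.
Context {S : signature} {A : algebra S} (theta : Con A).

Lemma con_uP (alpha : Con A) (a b : A) :
  con_rel (u theta alpha) (quot_pi theta a, quot_pi theta b) <->
  con_rel (alpha `|` theta) (a, b).
Proof. exact: u_relP. Qed.

Lemma pullback_is_congruence (beta : Con (quot theta)) :
  is_congruence
    [set p : A * A | con_rel beta (quot_pi theta p.1, quot_pi theta p.2)].
Proof.
have [r s t c] := conP beta; split=> [a|a b|a b d|f a b ab] /=.
- exact: r.
- exact: s.
- exact: t.
- by rewrite -!quot_opE; apply: c.
Qed.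

(** The pullback of [beta] along the quotient map contains [theta], so joining it with [theta]
    changes nothing. *)
Lemma u_surj (beta : Con (quot theta)) :
  exists alpha : Con A, u theta alpha = beta.
Proof.
pose alpha := MkCon (pullback_is_congruence beta); exists alpha.
have theta_le : theta <= alpha.
  apply/con_leP => -[a b] /quot_piP ab.
  by have [r _ _ _] := conP beta; rewrite /= ab; exact: r.
apply: con_eqP => x y; rewrite -(quot_reprK x) -(quot_reprK y).
by rewrite con_uP (join_idPl theta_le).
Qed.

End QuotientPullback.

Lemma CBLP_of_complemented (S : signature) (A : algebra S) :
  (forall alpha : Con A, complemented (Con A) alpha) -> CBLP A.
Proof.
by move=> cA theta beta _; have [alpha <-] := u_surj beta; exists alpha.
Qed.

(** * The lattice and its three coordinates *)

Definition sq_top : Type := option (bool * bool).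

Definition sq_meet (x y : sq_top) : sq_top :=
  match x, y with
  | None, z | z, None => z
  | Some (a, b), Some (c, d) => Some (a && c, b && d)
  end.

Definition sq_join (x y : sq_top) : sq_top :=
  match x, y with
  | None, _ | _, None => None
  | Some (a, b), Some (c, d) => Some (a || c, b || d)
  end.

Definition lattice_sig : signature := Signature (fun _ : bool => 2).

Definition sq_op (f : symbol lattice_sig) (x : 'I_(arity f) -> sq_top) : sq_top :=
  (if f then sq_meet else sq_join) (x ord0) (x ord_max).

Definition sq_alg : algebra lattice_sig := Algebra sq_op (inhabits None).

Lemma sq_congr2 (alpha : Con sq_alg) (f : bool) (x x' y y' : sq_top) :
  con_rel alpha (x, x') -> con_rel alpha (y, y') ->
  con_rel alpha ((if f then sq_meet else sq_join) x y,
                 (if f then sq_meet else sq_join) x' y').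
Proof.
move=> xx yy; have [_ _ _ c] := conP alpha.
apply: (c f (fun i : 'I_2 => if i == ord0 then x else y)
            (fun i : 'I_2 => if i == ord0 then x' else y')) => i.
by case: ifP.
Qed.

(** These are the characteristic functions of the three prime filters; [None] indexes the filter
    consisting of the new top alone. *)
Definition coord (i : option bool) (x : sq_top) : bool :=
  match i, x with
  | None, None | Some _, None => true
  | None, Some _ => false
  | Some true, Some (a, _) => a
  | Some false, Some (_, b) => b
  end.

Lemma coord_inj (x y : sq_top) : (forall i, coord i x = coord i y) -> x = y.
Proof.
move=> E; move: (E None) (E (Some true)) (E (Some false)).
by case: x y {E} => [[a b]|] [[c d]|] //= _ -> ->.
Qed.

Lemma coord_op (i : option bool) (f : bool) (x y : sq_top) :
  coord i ((if f then sq_meet else sq_join) x y) =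
  (if f then andb else orb) (coord i x) (coord i y).
Proof. by case: f i x y => -[[]|] [[[] []]|] [[[] []]|]. Qed.

(* [lo i < hi i] is a covering pair on which only the coordinate [i] differs. *)
Definition lo (i : option bool) : sq_top :=
  if i is None then Some (true, true) else Some (false, false).

Definition hi (i : option bool) : sq_top :=
  if i is Some b then Some (b, ~~ b) else None.

Lemma coord_lo_hi (i j : option bool) : coord j (lo i) = coord j (hi i) <-> i <> j.
Proof. by case: i j => [[]|] [[]|]. Qed.

(** This unary polynomial retracts the lattice onto the pair [lo i], [hi i]; congruences are
    preserved by it. *)
Lemma coord_retract (i : option bool) (x : sq_top) :
  sq_join (lo i) (sq_meet x (hi i)) = if coord i x then hi i else lo i.
Proof. by case: i x => [[]|] [[[] []]|]. Qed.

(** * Congruences as kernels of sets of coordinates *)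

Lemma ker_is_congruence (I : set (option bool)) :
  is_congruence
    [set p : sq_alg * sq_alg | forall i, I i -> coord i p.1 = coord i p.2].
Proof.
split=> [//|a b ab i /ab//|a b c ab bc i Ii|f a b ab i Ii] /=.
  by rewrite -[RHS]bc //; exact: ab.
by rewrite /sq_op !coord_op (ab ord0 i Ii) (ab ord_max i Ii).
Qed.

Definition ker (I : set (option bool)) : Con sq_alg := MkCon (ker_is_congruence I).

Lemma ker_leP (I J : set (option bool)) : ker I <= ker J <-> J `<=` I.
Proof.
split=> [/con_leP le j Jj|JI]; last by apply/con_leP => p pI j /JI; exact: pI.
(* If [j] is not in [I], the pair [lo j], [hi j] lies in [ker I], yet it is separated by [j]. *)
apply: contrapT => nIj.
have /coord_lo_hi// : coord j (lo j) = coord j (hi j).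
by apply: (le (lo j, hi j)) => //= i Ii; apply/coord_lo_hi => ji; rewrite ji in nIj.
Qed.

Lemma ker_inj : injective ker.
Proof.
by move=> I J IJ; apply/seteqP; split; apply/ker_leP; rewrite IJ.
Qed.

Lemma con_lo_hi (alpha : Con sq_alg) (i : option bool) (x y : sq_top) :
  con_rel alpha (x, y) -> coord i x <> coord i y -> con_rel alpha (lo i, hi i).
Proof.
have [r s _ _] := conP alpha => xy.
have := sq_congr2 false (r (lo i)) (sq_congr2 true xy (r (hi i))).
by rewrite !coord_retract; case: (coord i x) (coord i y) => -[] // /s.
Qed.

(** Coordinates can be changed one at a time: in the square, the two factors are treated separately
    and joined; the new top is reached through [lo None]. *)
Lemma con_of_lo_hi (alpha : Con sq_alg) (x y : sq_top) :
  (forall i, coord i x <> coord i y -> con_rel alpha (lo i, hi i)) ->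
  con_rel alpha (x, y).
Proof.
have [r s t _] := conP alpha.
have sq a b c d :
    (forall i, coord i (Some (a, b)) <> coord i (Some (c, d)) ->
      con_rel alpha (lo i, hi i)) ->
    con_rel alpha (Some (a, b), Some (c, d)).
  move=> H.
  have ac : con_rel alpha (Some (a, false), Some (c, false)).
    move: (H (Some true)) => /=.
    by case: a c {H} => -[] H; try exact: r; [apply: s|]; apply: H.
  have bd : con_rel alpha (Some (false, b), Some (false, d)).
    move: (H (Some false)) => /=.
    by case: b d {H} => -[] H; try exact: r; [apply: s|]; apply: H.
  by have := sq_congr2 false ac bd; rewrite /= !orbF.
have top a b : (forall i, coord i (Some (a, b)) <> coord i None ->
      con_rel alpha (lo i, hi i)) -> con_rel alpha (Some (a, b), None).
  move=> H; apply: (t _ (lo None)); last exact: H.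
  by apply: sq => -[[]|] // ne; apply: H.
case: x y => [[a b]|] [[c d]|] H; last exact: r.
- exact: sq.
- exact: top.
- by apply/s/top => i ne; apply: H; exact: nesym.
Qed.

Lemma con_ker (alpha : Con sq_alg) : exists I, alpha = ker I.
Proof.
(* The coordinates constant on [alpha]-classes; for any other coordinate [i], [alpha] contains the
   pair [lo i], [hi i]. *)
pose I : set (option bool) :=
  [set i | forall x y, con_rel alpha (x, y) -> coord i x = coord i y].
exists I; apply: con_eqP => x y; split=> [xy i Ii|xy]; first exact: Ii.
apply: con_of_lo_hi => i ne; apply: contrapT => n; apply/ne/xy => a b ab.
by apply: contrapT => /(con_lo_hi ab).
Qed.

Lemma ker_meet (I J : set (option bool)) : ker I `&` ker J = ker (I `|` J)%classic.
Proof.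
apply: con_eqP => x y; split=> [[xI xJ] i [/xI|/xJ]//|xy].
by split=> i ?; apply: xy; [left|right].
Qed.

Lemma ker_join (I J : set (option bool)) : ker I `|` ker J = ker (I `&` J)%classic.
Proof.
apply: le_anti; apply/andP; split.
  by rewrite leUx; apply/andP; split; apply/ker_leP => i [].
(* The join is itself some [ker L], and lying above both kernels forces [L] into both sets; the
   generated congruence need not be described. *)
have [L E] := con_ker (ker I `|` ker J); rewrite E; apply/ker_leP.
by rewrite subsetI; split; apply/ker_leP; rewrite -E ?leUl ?leUr.
Qed.

Lemma ker_setT : ker setT = \bot.
Proof.
apply: con_eqP => x y; split=> [xy|/diagonalP -> //].
by apply/diagonalP/coord_inj => i; exact: xy.
Qed.

Lemma ker_set0 : ker set0 = \top.
Proof. by apply: con_eqP => x y; split=> // _ i. Qed.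

(** * Distributivity and complements in the congruence lattice *)

Lemma sq_congruence_distributive : congruence_distributive sq_alg.
Proof.
move=> a b c; have [I ->] := con_ker a; have [J ->] := con_ker b.
have [L ->] := con_ker c.
by rewrite !(ker_meet, ker_join) setUIl.
Qed.

Lemma sq_complemented (alpha : Con sq_alg) : complemented (Con sq_alg) alpha.
Proof.
have [I ->] := con_ker alpha; exists (ker (~` I)).
by rewrite ker_meet ker_join setUCr setICr ker_setT ker_set0.
Qed.

(** * The quotient by [collapse] and the failure of FCLP *)

Definition collapse : Con sq_alg := ker [set~ None].

Lemma u_ker_Some (b : bool) (x y : sq_top) :
  con_rel (u collapse (ker [set Some b])) (quot_pi collapse x, quot_pi collapse y)
  <-> coord (Some b) x = coord (Some b) y.
Proof.
rewrite con_uP ker_join (_ : (_ `&` _)%classic = [set Some b]).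
  by split=> [|xy _ ->//]; apply.
by apply/seteqP; split=> i [] // ->.
Qed.

Lemma u_ker_comp (b : bool) :
  (con_rel (u collapse (ker [set Some b])) \;
   con_rel (u collapse (ker [set Some (~~ b)])) = setT)%relation.
Proof.
apply/seteqP; split=> // -[X Y] _.
rewrite -(quot_reprK X) -(quot_reprK Y).
move: (quot_repr X) (quot_repr Y) => x y.
(* The midpoint takes coordinate [Some b] from [y] and the other one from [x]. *)
exists (quot_pi collapse (Some (coord (Some true) (if b then y else x),
                                coord (Some false) (if b then x else y)))).
  by apply/u_ker_Some; case: b.
by apply/u_ker_Some; case: b.
Qed.

Lemma FC_u_ker : FC (quot collapse) (u collapse (ker [set Some true])).
Proof.
exists (u collapse (ker [set Some false])); split.
- apply: con_eqP => x y; split=> // _.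
  (* A full composite already forces the join to be full. *)
  have : (con_rel (u collapse (ker [set Some true])) \;
          con_rel (u collapse (ker [set Some (~~ true)])))%relation (x, y).
    by rewrite u_ker_comp.
  move=> [z xz zy]; apply: (con_trans (b := z)).
    by move: xz; apply/con_leP; exact: leUr.
  by move: zy; apply/con_leP; exact: leUl.
- apply: con_eqP => X Y; rewrite -(quot_reprK X) -(quot_reprK Y).
  move: (quot_repr X) (quot_repr Y) => x y.
  split=> [[/u_ker_Some e1 /u_ker_Some e2]|/diagonalP/quot_piP xy].
    by apply/diagonalP/quot_piP => -[[]|] ne; [exact: e1|exact: e2|case: ne].
  by split; apply/u_ker_Some; apply: xy.
- by rewrite (u_ker_comp true) (u_ker_comp false).
Qed.

(** A lift [ker I] with complement [ker J] would split the coordinates into [I] and [J], each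
    containing one coordinate of the square. Whichever of them contains [None], the two kernels fail
    to permute. *)
Lemma sq_not_FCLP : ~ FCLP sq_alg.
Proof.
move=> /(_ collapse _ FC_u_ker)[alpha [alpha' [jT mB comm]] ua].
have [I aI] := con_ker alpha; have [J aJ] := con_ker alpha'.
rewrite {}aI {}aJ in jT mB comm ua.
have IJ0 i : I i -> J i -> False.
  move: jT; rewrite ker_join -ker_set0 => /ker_inj E Ii Ji.
  by rewrite -[False]/(set0 i) -E.
have IJT i : I i \/ J i.
  move: mB; rewrite ker_meet -ker_setT => /ker_inj E.
  by rewrite -[_ \/ _]/((I `|` J)%classic i) E.
(* Otherwise the image of [ker I] would relate two elements differing at [Some true]. *)
have It : I (Some true).
  case: (IJT (Some true)) => // Jt.
  have /u_ker_Some // : con_rel (u collapse (ker [set Some true]))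
     (quot_pi collapse (lo (Some true)), quot_pi collapse (hi (Some true))).
  rewrite -ua con_uP ker_join => i [Ii _].
  by apply/coord_lo_hi => ti; rewrite -ti in Ii; exact: IJ0 Ii Jt.
(* Otherwise the image of [ker I] would preserve [Some false], which the given factor congruence
   does not. *)
have Jf : J (Some false).
  case: (IJT (Some false)) => // If.
  have : con_rel (u collapse (ker [set Some true]))
     (quot_pi collapse (lo (Some false)), quot_pi collapse (hi (Some false))).
    exact/u_ker_Some.
  rewrite -ua con_uP ker_join => H.
  by suff : false = true by []; apply: (H (Some false)).
pose bot : sq_alg := Some (false, false); pose top : sq_alg := None.
(* One composite relates [top] and [bot] through an atom. In the other order, coordinate [None]
   forces the midpoint to be [top], which differs from [bot] at a coordinate of the other set. *)
have [IN|JN] := IJT None.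
- have : (con_rel (ker I) \; con_rel (ker J))%relation (top, bot).
    by exists (hi (Some false)) => -[[]|] // /IJ0 [].
  rewrite comm => -[[[a b]|] /= zI zJ]; first by have := zI _ IN.
  by have := zJ _ Jf.
- have : (con_rel (ker I) \; con_rel (ker J))%relation (bot, top).
    by exists (hi (Some true)) => -[[]|] // /IJ0 [].
  rewrite comm => -[[[a b]|] /= zI zJ]; first by have := zJ _ JN.
  by have := zI _ It.
Qed.

Theorem corollary4p7 :
  exists (S : signature) (A : algebra S),
    congruence_distributive A /\ CBLP A /\ ~ FCLP A.
Proof.
exists lattice_sig, sq_alg; split; first exact: sq_congruence_distributive.
by split; [exact: CBLP_of_complemented sq_complemented | exact: sq_not_FCLP].
Qed.
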